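(* Let $p$ be a prime, let $\mathcal{F}$ be any fusion system over a finite $p$-group $S$, and let $B$ be a $\mathbb{Z}$-basis of $R_{\mathbb{C}}(\mathcal{F})$. Then $|\det(X_B(\mathcal{F}))|^2$ is a power of $p$.
   Context: A fusion system $\mathcal{F}$ over $S$ is a category whose objects are the subgroups of $S$, whose morphism sets $\mathrm{Hom}_{\mathcal{F}}(P,Q)$ consist of injective group homomorphisms $P\to Q$ (with usual composition), such that every homomorphism $P\to Q$ induced by conjugation by an element of $S$ lies in $\mathrm{Hom}_{\mathcal{F}}(P,Q)$, and every morphism is the composite of an isomorphism in $\mathcal{F}$ followed by an inclusion. No saturation is assumed. The $\mathcal{F}$-conjugacy class of $s\in S$ is $s^{\mathcal{F}}=\{s'\in S: \exists P,Q\le S,\ \exists\phi\in\mathrm{Hom}_{\mathcal{F}}(P,Q)\text{ with }\phi(s')=s\}$; $\mathrm{cl}(\mathcal{F})$ is the set of these classes. A class function on $S$ is $\mathcal{F}$-stable if it is constant on $\mathcal{F}$-conjugacy classes. $R_{\mathbb{C}}(\mathcal{F})$ is the ring of $\mathcal{F}$-stable virtual complex characters of $S$; it is a free abelian group of rank $|\mathrm{cl}(\mathcal{F})|$. For a $\mathbb{Z}$-basis $B$ of it, $X_B(\mathcal{F})$ is the square matrix $(\psi(x))_{\psi\in B,\,x^{\mathcal{F}}\in\mathrm{cl}(\mathcal{F})}$. A power of $p$ means $p^{\alpha}$ with $\alpha$ a non-negative integer. *)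

(* Defs.v *)
From HB Require Import structures.
From mathcomp Require Import all_boot all_order all_algebra.
From mathcomp Require Import all_fingroup all_solvable all_field all_character.

Set Implicit Arguments.
Unset Strict Implicit.
Unset Printing Implicit Defensive.

Import Order.TTheory GRing.Theory Num.Theory.
Local Open Scope ring_scope.

(* The objects are the subgroups of S: [fs_obj] says that [fs_hom P Q] is     *)
(* empty for the other groups P, Q of the ambient type. Identities and        *)
(* inclusions are the case s = 1 of [fs_conj].                                *)
Record fusion_system (gT : finGroupType) (S : {group gT}) := FusionSystem {
  fs_hom : forall P Q : {group gT}, {set {ffun subg_of P -> subg_of Q}};
  fs_obj : forall (P Q : {group gT}) (phi : {ffun subg_of P -> subg_of Q}),
    phi \in fs_hom P Q -> P \subset S /\ Q \subset S;
  fs_morph : forall (P Q : {group gT}) (phi : {ffun subg_of P -> subg_of Q}),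
    phi \in fs_hom P Q -> {morph phi : x y / (x * y)%g};
  fs_inj : forall (P Q : {group gT}) (phi : {ffun subg_of P -> subg_of Q}),
    phi \in fs_hom P Q -> injective phi;
  fs_comp : forall (P Q R : {group gT}) (phi : {ffun subg_of P -> subg_of Q})
      (psi : {ffun subg_of Q -> subg_of R}),
    phi \in fs_hom P Q -> psi \in fs_hom Q R ->
    [ffun x => psi (phi x)] \in fs_hom P R;
  fs_conj : forall (P Q : {group gT}) (s : gT)
      (phi : {ffun subg_of P -> subg_of Q}),
    P \subset S -> Q \subset S -> s \in S ->
    (forall x, sgval (phi x) = (sgval x ^ s)%g) -> phi \in fs_hom P Q;
  fs_factor : forall (P Q : {group gT}) (phi : {ffun subg_of P -> subg_of Q}),
    phi \in fs_hom P Q ->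
    exists (R : {group gT}) (psi : {ffun subg_of P -> subg_of R})
           (psi' : {ffun subg_of R -> subg_of P}),
      [/\ psi \in fs_hom P R, psi' \in fs_hom R P,
          cancel psi psi' /\ cancel psi' psi, R \subset Q
        & forall x, sgval (phi x) = sgval (psi x)]
}.

Section FusionCharacters.

Variables (gT : finGroupType) (S : {group gT}) (F : fusion_system S).

Definition fs_class (s : gT) : {set gT} :=
  [set s' in S | [exists P : {group gT}, exists Q : {group gT},
     exists phi in fs_hom F P Q, exists x : subg_of P,
       (sgval x == s') && (sgval (phi x) == s)]].

Definition fs_classes : {set {set gT}} := [set fs_class s | s in S].

Definition fs_stable (phi : 'CF(S)) : bool :=
  [forall C in fs_classes, forall x in C, forall y in C, phi x == phi y].

Definition fs_vchar : {pred 'CF(S)} :=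
  [pred phi | (phi \in 'Z[irr S]%g) && fs_stable phi].

(* [repr C] is an element of C whenever C is nonempty. *)
Definition fs_table (B : #|fs_classes|.-tuple 'CF(S)) : 'M[algC]_#|fs_classes| :=
  \matrix_(i, j) tnth B i (repr (enum_val j)).

End FusionCharacters.

Definition Z_basis (V : zmodType) (A : {pred V}) (n : nat) (B : n.-tuple V) :=
  (forall i, tnth B i \in A) /\
  (forall v, v \in A ->
     exists! a : {ffun 'I_n -> int}, v = \sum_i tnth B i *~ a i).

(* Main.v *)
(* Write X for the table and D for the diagonal matrix of the class sizes.    *)
(* The F-stable virtual characters form a saturated sublattice of Z[irr S],   *)
(* so by the Smith normal form B has a dual family of virtual characters v_k  *)
(* of S, '[B_i, v_k] = delta_ik. Grouping these scalar products by F-classes  *)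
(* gives X A = |S| I where A_Ck, the sum of the conjugates of v_k(x) for x in *)
(* C, is an algebraic integer. Grouping the '[B_i, B_k] instead expresses     *)
(* X D X^* as |S| times an integral Gram matrix, so |det X|^2 is rational.    *)
(* Hence |det X|^2 and |det A|^2 are natural numbers, and their product is a  *)
(* power of |S|.                                                              *)

Require Import Defs.
From mathcomp Require Import all_boot all_order all_algebra.
From mathcomp Require Import all_fingroup all_solvable all_field all_character.

Import Order.TTheory GRing.Theory Num.Theory.
Local Open Scope ring_scope.

(** Integrality of |det X|^2 alone does not control its prime divisors; a complementary factor does.
    A dual family of [B] turns the table [X] into a left factor of |S| I whose cofactor [A] again
    has algebraic integer entries, so |det X|^2 divides a power of |S| as soon as both squared norms
    are integers. [dual_vchar] builds the dual family from [saturated_int_mx_right_inverse] and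
    [fs_vchar_saturated]; [fs_cfdotE] converts scalar products into matrix products, given that
    F-classes partition S ([fs_classes_partition]). Rationality of |det X|^2 comes from the Gram
    matrix of [B]. *)

(** In the Smith form M = L D R every diagonal entry is a unit. With u the i-th row of the inverse
    of L, u M is d_i times a row of R; saturation writes that row as b M, injectivity gives u = d_i
    b, and since u L is a unit vector, d_i divides 1. Inverting L, D and R then gives the right
    inverse. *)
Lemma saturated_int_mx_right_inverse (m n : nat) (M : 'M[int]_(m, n)) :
    (forall a : 'rV_m, a *m M = 0 -> a = 0) ->
    (forall (w : 'rV_n) (d : int) (a : 'rV_m), d != 0 -> d *: w = a *m M ->
       exists b : 'rV_m, w = b *m M) ->
  exists V : 'M_(n, m), M *m V = 1%:M.
Proof.
move=> injM satM.
have [L uL [R uR [d _ defM]]] := int_Smith_normal_form M.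
set D := \matrix_(i, j) _ in defM.
have LiM : invmx L *m M = D *m R by rewrite defM -mulmxA mulKmx.
have DiP (i : 'I_m) : (i < n)%N /\ d`_i \is a GRing.unit.
  pose u := row i (invmx L).
  have uM : u *m M = row i D *m R by rewrite -row_mul LiM row_mul.
  have uL1 : u *m L = row i 1%:M by rewrite -row_mul mulVmx.
  have uM_n0 : u *m M != 0.
    apply/eqP=> /injM u0; move: uL1; rewrite u0 mul0mx.
    by move/rowP/(_ i); rewrite !mxE eqxx.
  (* When row i lies below the last column, [row i D] vanishes, against [uM_n0]. *)
  have [lt_in | le_ni] := ltnP i n; last first.
    case/eqP: uM_n0; rewrite uM (_ : row i D = 0) ?mul0mx //.
    apply/rowP=> j; rewrite !mxE; case: eqP => // ij.
    by have := ltn_ord j; rewrite -ij ltnNge le_ni.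
  split=> //; pose r := row (Ordinal lt_in) R.
  have uMr : u *m M = d`_i *: r.
    rewrite uM; apply/rowP=> j; rewrite !mxE (bigD1 (Ordinal lt_in)) //= big1.
      by rewrite !mxE eqxx addr0.
    by move=> k; rewrite !mxE eq_sym -val_eqE /= eq_sym => /negPf->; rewrite mul0r.
  have d_n0 : d`_i != 0 by apply: contraNneq uM_n0 => d0; rewrite uMr d0 scale0r.
  have [b defr] := satM r d`_i u d_n0 (esym uMr).
  have : u = d`_i *: b.
    apply/eqP; rewrite -subr_eq0; apply/eqP/injM.
    by rewrite mulmxBl -scalemxAl -defr uMr subrr.
  move=> defu; have /rowP/(_ i) := uL1.
  rewrite defu -scalemxAl !mxE eqxx => db1.
  by apply/unitrPr; exists (\sum_j b 0 j * L j i); rewrite db1.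
pose E : 'M[int]_(n, m) := \matrix_(i, j) ((d`_j)^-1 *+ (i == j :> nat)).
exists (invmx R *m E *m invmx L).
have DE : D *m E = 1%:M.
  apply/matrixP=> i k; have [lt_in ud] := DiP i.
  rewrite !mxE (bigD1 (Ordinal lt_in)) //= big1 => [|j].
    rewrite !mxE eqxx addr0 -val_eqE /=.
    by case: eqP => [<-|_]; rewrite ?mulr0 // mulrV.
  by rewrite !mxE eq_sym -val_eqE /= eq_sym => /negPf->; rewrite mul0r.
by rewrite defM !mulmxA mulmxK // -(mulmxA L) DE mulmx1 mulmxV.
Qed.

(** Linear independence is the uniqueness clause of [Z_basis] at v = 0; that clause only covers
    members of [A], hence [0 \in A]. *)
Lemma Z_basis_inj (V : zmodType) (A : {pred V}) (n : nat) (B : n.-tuple V)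
    (a : 'I_n -> int) :
  Z_basis A B -> 0 \in A -> \sum_i tnth B i *~ a i = 0 -> forall i, a i = 0.
Proof.
case=> _ basisB A0 a0 i; have [b [_ uniq_b]] := basisB 0 A0.
have -> : a i = [ffun i => a i] i by rewrite ffunE.
rewrite -(uniq_b [ffun i => a i]); last first.
  by rewrite -[LHS]a0; apply: eq_bigr => j _; rewrite ffunE.
rewrite (uniq_b [ffun => 0]) ?ffunE // big1 // => j _.
by rewrite ffunE mulr0z.
Qed.

Lemma dual_vchar (gT : finGroupType) (G : {group gT}) (A : {pred 'CF(G)})
    (n : nat) (B : n.-tuple 'CF(G)) :
    Z_basis A B -> {subset A <= 'Z[irr G]%g} ->
    0 \in A ->
    (forall (phi : 'CF(G)) (d : int),
       phi \in 'Z[irr G]%g -> d != 0 ->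
       (exists a : 'I_n -> int, phi *~ d = \sum_i tnth B i *~ a i) -> phi \in A) ->
  exists v : 'I_n -> 'CF(G), (forall k, v k \in 'Z[irr G]%g) /\
    (forall i k, '[tnth B i, v k] = (i == k)%:R).
Proof.
move=> basisB ZA A0 satA; have [AB spanB] := basisB.
pose chi (w : 'I_(Nirr G) -> int) := \sum_j 'chi[G]_j *~ w j.
have Zchi w : chi w \in 'Z[irr G]%g.
  by apply: rpred_sum => j _; rewrite rpredMz ?irr_vchar.
have dot_chi w j : '[chi w, 'chi_j] = (w j)%:~R.
  rewrite cfdot_suml (bigD1 j) //= big1 ?addr0 => [|k /negPf jk].
    by rewrite -scaler_int cfdotZl cfdot_irr eqxx mulr1.
  by rewrite -scaler_int cfdotZl cfdot_irr jk mulr0.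
have chi_inj w1 w2 : chi w1 = chi w2 -> w1 =1 w2.
  move=> eq_w j; apply: (@intr_inj algC).
  by rewrite -!dot_chi eq_w.
have chiP phi : phi \in 'Z[irr G]%g -> phi = chi (fun j => Num.floor '[phi, 'chi_j]).
  move=> Zphi; rewrite {1}[phi]cfun_sum_cfdot; apply: eq_bigr => j _.
  by rewrite -scaler_int floorK ?Cint_cfdot_vchar_irr.
(* The coordinates of [B] in the irreducible characters; they are integers, and [Num.floor] only
   moves them from [algC] to [int]. *)
pose M := \matrix_(i, j) Num.floor '[tnth B i, 'chi_j].
have chiM (a : 'rV_n) : chi ((a *m M) 0) = \sum_i tnth B i *~ a 0 i.
  transitivity (\sum_i \sum_j 'chi[G]_j *~ (a 0 i * M i j)).
    by rewrite exchange_big; apply: eq_bigr => j _; rewrite mxE mulrz_sumr.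
  apply: eq_bigr => i _; rewrite [in RHS](chiP _ (ZA _ (AB i))).
  rewrite mulrz_suml; apply: eq_bigr => j _.
  by rewrite mxE mulrC mulrzA.
have [|w d a d_n0 defw|V MV1] := saturated_int_mx_right_inverse n _ M.
- move=> a aM0; apply/rowP=> i; rewrite mxE.
  apply: (Z_basis_inj _ _ _ _ (a 0) basisB A0); rewrite -chiM aM0.
  by rewrite /chi big1 // => j _; rewrite mxE mulr0z.
- have /spanB [b [defchi _]] : chi (w 0) \in A.
    apply: (satA _ d) => //; exists (a 0); rewrite -chiM -defw.
    by rewrite mulrz_suml; apply: eq_bigr => j _; rewrite mxE mulrC mulrzA.
  exists (\row_i b i); apply/rowP/chi_inj; rewrite chiM defchi.
  by apply: eq_bigr => i _; rewrite mxE.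
(* Column k of V holds the coordinates of the k-th dual vector: irreducible characters are
   orthonormal, so M V = 1 is the duality relation. *)
exists (fun k => chi (V^~ k)); split=> [k | i k]; first exact: Zchi.
have /matrixP/(_ i k) := MV1; rewrite !mxE => /(congr1 (intr : int -> algC)).
rewrite rmorph_nat => <-.
rewrite (chiP _ (ZA _ (AB i))) cfdot_vchar_r // rmorph_sum.
by apply: eq_bigr => j _; rewrite !dot_chi -rmorphM mxE.
Qed.

Lemma fs_classP {gT : finGroupType} {S : {group gT}} {F : fusion_system S}
    {s s' : gT} :
  reflect (exists (P Q : {group gT}) (phi : {ffun subg_of P -> subg_of Q})
             (x : subg_of P),
             [/\ phi \in fs_hom F P Q, sgval x = s' & sgval (phi x) = s])
          (s' \in fs_class F s).
Proof.
apply: (iffP idP).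
  rewrite inE => /andP[_ /existsP[P /existsP[Q /existsP[phi]]]].
  case/andP=> Fphi /existsP[x /andP[/eqP xs' /eqP xs]].
  by exists P, Q, phi, x.
case=> P [Q [phi [x [Fphi xs' xs]]]]; rewrite inE.
have [sPS _] := fs_obj Fphi.
rewrite -{1}xs' (subsetP sPS) ?subgP //=.
apply/existsP; exists P; apply/existsP; exists Q; apply/existsP; exists phi.
by rewrite Fphi /=; apply/existsP; exists x; rewrite xs' xs !eqxx.
Qed.

Lemma fs_incl {gT : finGroupType} {S : {group gT}} (F : fusion_system S)
    (P Q : {group gT}) :
  P \subset Q -> Q \subset S ->
  exists2 phi : {ffun subg_of P -> subg_of Q},
    phi \in fs_hom F P Q & forall x, sgval (phi x) = sgval x.
Proof.
move=> sPQ sQS; have val_phi (x : subg_of P) : sgval (subg Q (sgval x)) = sgval x.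
  by rewrite subgK // (subsetP sPQ) ?subgP.
exists [ffun x : subg_of P => subg Q (sgval x)] => [|x]; last by rewrite ffunE.
apply: (@fs_conj _ _ F P Q 1%g) => // [|x]; first exact: subset_trans sPQ sQS.
by rewrite ffunE val_phi conjg1.
Qed.

(* Both maps come from factoring the restriction to <[x]> of a morphism that  *)
(* sends x to y: its image is <[y]>.                                          *)
Lemma fs_class_cycle {gT : finGroupType} {S : {group gT}} {F : fusion_system S}
    {x y : gT} : x \in fs_class F y ->
  exists (phi : {ffun subg_of <[x]>%G -> subg_of <[y]>%G})
         (psi : {ffun subg_of <[y]>%G -> subg_of <[x]>%G}),
    [/\ phi \in fs_hom F <[x]>%G <[y]>%G, psi \in fs_hom F <[y]>%G <[x]>%G,
        sgval (phi (subg _ x)) = y & sgval (psi (subg _ y)) = x].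
Proof.
case/fs_classP=> P [Q [phi [a [Fphi ax ay]]]].
have [sPS sQS] := fs_obj Fphi.
have Px : x \in P by rewrite -ax subgP.
have sxP : <[x]>%G \subset P by rewrite cycle_subG.
have [i Fi val_i] := fs_incl F _ _ sxP sPS.
have [R [psi [psi' [Fpsi Fpsi' [psiK psi'K] _ val_psi]]]] :=
  fs_factor (fs_comp Fi Fphi).
have psix : sgval (psi (subg _ x)) = y.
  rewrite -val_psi ffunE -ay; congr (sgval (phi _)); apply: val_inj.
  by rewrite /= val_i subgK ?cycle_id.
have defR : R = <[y]>%G.
  apply/val_inj/eqP; rewrite eqEsubset /= cycle_subG.
  have -> : y \in R by rewrite -psix subgP.
  rewrite andbT.
  apply/subsetP=> r Rr; pose r' := psi' (subg R r).
  (* Pulled back by [psi'], r becomes x ^+ k, so r itself is y ^+ k. *)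
  have [k def_r'] := cycleP _ _ (subgP r').
  pose g := Morphism (fun u v _ _ => fs_morph Fpsi u v) : {morphism setT >-> _}.
  have -> : r = (y ^+ k)%g; last exact: mem_cycle.
  have -> : r = sgval (psi r') by rewrite psi'K subgK.
  have -> : r' = (subg _ x ^+ k)%g.
    apply: (can_inj sgvalK).
    by rewrite def_r' (morphX (sgval_morphism _)) ?inE //= subgK ?cycle_id.
  by rewrite -psix -(morphX (sgval_morphism _)) ?inE // -(morphX g) ?inE.
subst R; exists psi, psi'; split=> //.
have -> : subg <[y]>%G y = psi (subg _ x).
  by apply: val_inj; rewrite /= psix subgK ?cycle_id.
by rewrite psiK subgK ?cycle_id.
Qed.

(** Morphisms witnessing conjugacy may have unrelated sources and targets. Replacing them by the
    maps of [fs_class_cycle] between cyclic subgroups makes them reversible and composable. *)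
Lemma fs_class_equiv (gT : finGroupType) (S : {group gT}) (F : fusion_system S) :
  {in S & &, equivalence_rel (fun x y => y \in fs_class F x)}.
Proof.
have sym x y : x \in fs_class F y -> y \in fs_class F x.
  case/fs_class_cycle=> _ [psi [_ Fpsi _ psiy]]; apply/fs_classP.
  by exists <[y]>%G, <[x]>%G, psi, (subg _ y); rewrite subgK ?cycle_id.
have trans x y z : x \in fs_class F y -> y \in fs_class F z -> x \in fs_class F z.
  case/fs_class_cycle=> phi [_ [Fphi _ phix _]].
  case/fs_class_cycle=> psi [_ [Fpsi _ psiy _]]; apply/fs_classP.
  exists <[x]>%G, <[z]>%G, [ffun a => psi (phi a)], (subg _ x).
  rewrite (fs_comp Fphi Fpsi) subgK ?cycle_id // ffunE; split=> //.
  rewrite -[RHS]psiy; congr (sgval (psi _)); apply: val_inj.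
  by rewrite /= phix subgK ?cycle_id.
move=> x y z _ _ Sz; split=> [|xy].
  have szS : <[z]>%G \subset S by rewrite cycle_subG.
  have [phi Fphi val_phi] := fs_incl F _ _ (subxx <[z]>%G) szS.
  apply/fs_classP; exists <[z]>%G, <[z]>%G, phi, (subg _ z).
  by rewrite val_phi subgK ?cycle_id.
apply/idP/idP=> [xz | yz]; first exact: trans xz (sym _ _ xy).
exact: trans yz xy.
Qed.

Lemma fs_classes_partition (gT : finGroupType) (S : {group gT})
    (F : fusion_system S) : partition (fs_classes F) S.
Proof.
have -> : fs_classes F = equivalence_partition (fun x y => y \in fs_class F x) S.
  apply: eq_imset => x; apply/setP=> y.
  by rewrite [RHS]inE andb_idl // inE => /andP[].
exact/equivalence_partitionP/fs_class_equiv.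
Qed.

Lemma fs_stableP {gT : finGroupType} {S : {group gT}} {F : fusion_system S}
    {phi : 'CF(S)} :
  reflect {in fs_classes F, forall C : {set gT}, {in C &, forall x y, phi x = phi y}}
          (fs_stable F phi).
Proof.
apply: (iffP forall_inP) => phiC C FC.
  by move=> x y Cx Cy; apply/eqP/(forall_inP (forall_inP (phiC C FC) x Cx)).
by apply/forall_inP=> x Cx; apply/forall_inP=> y Cy; apply/eqP/(phiC C).
Qed.

Lemma fs_stable_repr {gT : finGroupType} {S : {group gT}} {F : fusion_system S}
    {phi : 'CF(S)} {C : {set gT}} {x : gT} :
  fs_stable F phi -> C \in fs_classes F -> x \in C -> phi x = phi (repr C).
Proof. by move=> /fs_stableP phiC FC Cx; apply: phiC FC _ _ Cx (mem_repr _ Cx). Qed.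

(** The stable factor is constant on each F-class and comes out of the sum over it. [psi] is
    arbitrary so that the dual vectors, which need not be F-stable, can take its place. *)
Lemma fs_cfdotE (gT : finGroupType) (S : {group gT}) (F : fusion_system S)
    (phi psi : 'CF(S)) : fs_stable F phi ->
  #|S|%:R * '[phi, psi]
    = \sum_(j < #|fs_classes F|)
         phi (repr (enum_val j)) * \sum_(x in enum_val j) (psi x)^*.
Proof.
move=> Fphi; have /and3P[/eqP covS tiF _] := fs_classes_partition _ _ F.
rewrite cfdotE mulVKf ?neq0CG // -{1}covS big_trivIset //=.
rewrite -(big_enum_val (fun C => phi (repr C) * \sum_(x in C) (psi x)^* )).
apply: eq_bigr => C FC; rewrite mulr_sumr.
by apply: eq_bigr => x Cx; rewrite (fs_stable_repr Fphi FC Cx).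
Qed.

Lemma rpred_det (R : comPzRingType) (P : subringClosed R) (n : nat) (A : 'M[R]_n) :
  (forall i j, A i j \in P) -> \det A \in P.
Proof.
move=> PA; apply: rpred_sum => s _; rewrite rpredMsign.
exact: rpred_prod.
Qed.

(** Stability is a set of equalities between complex values, from which a nonzero integer factor
    cancels. *)
Lemma fs_vchar_saturated (gT : finGroupType) (S : {group gT})
    (F : fusion_system S) (phi : 'CF(S)) (d : int) :
  phi \in 'Z[irr S]%g -> d != 0 -> fs_stable F (phi *~ d) -> phi \in fs_vchar F.
Proof.
move=> Zphi d_n0 /fs_stableP Fphi; rewrite inE Zphi /=.
apply/fs_stableP=> C FC x y Cx Cy; have := Fphi C FC x y Cx Cy.
rewrite -scaler_int !cfunE; apply: mulfI.
by rewrite intr_eq0.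
Qed.

Lemma fs_stable_Zspan (gT : finGroupType) (S : {group gT})
    (F : fusion_system S) (n : nat) (B : n.-tuple 'CF(S)) (a : 'I_n -> int) :
  (forall i, fs_stable F (tnth B i)) -> fs_stable F (\sum_i tnth B i *~ a i).
Proof.
move=> FB; apply/fs_stableP=> C FC x y Cx Cy; rewrite !sum_cfunE.
by apply: eq_bigr => i _; rewrite -scaler_int !cfunE (fs_stableP (FB i) C FC x y).
Qed.

Theorem theoremB (p : nat) (p_pr : prime p) (gT : finGroupType)
    (S : {group gT}) (pS : (p.-group S)%g) (F : fusion_system S)
    (B : #|fs_classes F|.-tuple 'CF(S)) (B_basis : Z_basis (fs_vchar F) B) :
  exists a : nat, `|\det (fs_table B)| ^+ 2 = (p ^ a)%N%:R.
Proof.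
have /all_and2[ZB FB] i : tnth B i \in 'Z[irr S]%g /\ fs_stable F (tnth B i).
  by apply/andP; case: B_basis => /(_ i).
have [|||v [Zv Bv]] := dual_vchar _ _ _ _ _ B_basis.
- by move=> phi /andP[].
- rewrite inE cfun0_zchar; apply/fs_stableP=> C _ x y _ _.
  by rewrite !cfunE.
- move=> phi d Zphi d_n0 [a phi_d]; apply: (fs_vchar_saturated _ _ _ _ d) => //.
  by rewrite phi_d fs_stable_Zspan.
set X := fs_table B; set n := #|fs_classes F| in X *.
pose cls (j : 'I_n) : {set gT} := enum_val (A := fs_classes F) j.
pose A : 'M_n := \matrix_(j, k) \sum_(x in cls j) (v k x)^*.
have XA : X *m A = #|S|%:R%:M.
  apply/matrixP=> i k; rewrite !mxE -[RHS]mulr_natr -Bv (fs_cfdotE _ _ _ _ _ (FB i)).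
  by apply: eq_bigr => j _; rewrite !mxE.
pose c : 'rV[algC]_n := \row_j #|cls j|%:R.
pose G : 'M_n := \matrix_(i, k) Num.floor '[tnth B i, tnth B k].
have XX : X *m (diag_mx c *m (map_mx Num.conj X)^T) = #|S|%:R *: map_mx intr G.
  apply/matrixP=> i k; rewrite !mxE floorK ?Cint_cfdot_vchar //.
  rewrite (fs_cfdotE _ _ _ _ _ (FB i)); apply: eq_bigr => j _.
  rewrite mul_diag_mx !mxE mulr_natl -sumr_const; congr (_ * _).
  apply: eq_bigr => x Cx; congr (_ ^*).
  by rewrite (fs_stable_repr (FB k) _ Cx) ?enum_valP.
have AintX : \det X \in Aint.
  by apply: rpred_det => i j; rewrite mxE Aint_vchar.
have AintA : \det A \in Aint.
  apply: rpred_det => j k; rewrite mxE; apply: rpred_sum => x _.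
  by rewrite Aint_aut Aint_vchar.
have AintN z : z \in Aint -> `|z| ^+ 2 \in Aint.
  by move=> Az; rewrite normCK rpredM ?Aint_aut.
have det_prod : `|\det X| ^+ 2 * `|\det A| ^+ 2 = (#|S| ^ (n * 2))%:R.
  rewrite -exprMn -normrM -det_mulmx XA det_scalar normrX normr_nat -exprM.
  by rewrite natrX.
have S_n0 : (#|S| ^ (n * 2))%:R != 0 :> algC.
  by rewrite pnatr_eq0 -lt0n expn_gt0 cardG_gt0.
have ratX : `|\det X| ^+ 2 \in Crat.
  (* The class sizes are nonzero because a partition has no empty block. *)
  have c_n0 : \det (diag_mx c) != 0.
    rewrite det_diag; apply/prodf_neq0=> j _; rewrite mxE pnatr_eq0 cards_eq0.
    have /and3P[_ _ F0] := fs_classes_partition _ _ F.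
    by apply: contraNneq F0 => <-; apply: enum_valP.
  have -> : `|\det X| ^+ 2 = #|S|%:R ^+ n * (\det G)%:~R / \det (diag_mx c).
    apply: (canRL (mulfK c_n0)); rewrite -det_map_mx -detZ -XX !det_mulmx.
    by rewrite det_tr det_map_mx normCK mulrAC mulrA.
  rewrite rpred_div ?rpredM ?rpredX ?rpred_nat ?rpred_int //.
  by apply: rpred_det => i j; rewrite !mxE rpredMn ?rpred_nat.
have natX : `|\det X| ^+ 2 \is a Num.nat.
  (* A rational algebraic integer is an integer. *)
  by rewrite natrEint exprn_ge0 ?Cint_rat_Aint ?AintN.
have natA : `|\det A| ^+ 2 \is a Num.nat.
  rewrite natrEint exprn_ge0 // Cint_rat_Aint ?AintN //.
  have X_n0 : `|\det X| ^+ 2 != 0.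
    by apply: contraNneq S_n0 => X0; rewrite -det_prod X0 mul0r.
  (* |det A|^2 is rational as the quotient of a power of |S| by the nonzero integer |det X|^2. *)
  by rewrite (canRL (mulKf X_n0) det_prod) rpredM ?rpredV ?rpred_nat.
have [[a defX] [b defA]] := (natrP natX, natrP natA).
have /p_natP[e defS] := pS.
(* With |S| = p^e, [det_prod] reads a b = p^(2en) in natural numbers, so a is a power of p. *)
have /(dvdn_pfactor _ _ p_pr)[m _ defa] : (a %| p ^ (e * (n * 2)))%N.
  rewrite expnM -defS; apply/dvdnP; exists b.
  by apply/eqP; rewrite -(eqr_nat algC) (mulnC b) natrM -defX -defA det_prod.
by exists m; rewrite defX defa.
Qed.
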